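(* The game $\mathcal{F}$-Wythoff is strongly miserable.
   Context: $\lfloor\cdot\rfloor$ is the integer part. A position is an unordered pair $(a,b)$ of nonnegative integers (two piles of tokens); $(a,b)$ is identified with $(b,a)$. $\mathcal{F}$-Wythoff is the impartial game with the following legal moves: (i) remove any positive number of tokens from one pile; (ii) remove the same positive number $k$ of tokens from both piles, provided the integer ratio of the two entries does not change, i.e. from $(a,b)$ with $1\le a\le b$ one may move to $(a-k,b-k)$ with $1\le k<a$ if $\lfloor (b-k)/(a-k)\rfloor=\lfloor b/a\rfloor$. The followers of $p$ are the positions reachable from $p$ by one legal move. For a finite set $S$ of nonnegative integers, $\mathrm{mex}(S)$ is the smallest nonnegative integer not in $S$ (so $\mathrm{mex}\,\emptyset=0$). For an impartial game $G$, the (normal play) Sprague-Grundy function is $\mathcal{G}_G(p)=\mathrm{mex}\{\mathcal{G}_G(q)\mid q \text{ is a follower of } p\}$. The mis\`ere version of $G$ (the player making the last move loses) is modelled by adding to the graph of $G$ one extra sink vertex and an edge from each terminal position of $G$ to it; $\mathcal{G}^-_G$ is the mex-recursive Sprague-Grundy function on this enlarged graph. Thus $\mathcal{G}^-_G(p)=1$ for each terminal position $p$ of $G$, and $\mathcal{G}^-_G(p)=\mathrm{mex}\{\mathcal{G}^-_G(q)\mid q \text{ is a follower of } p\}$ for every other position $p$ of $G$. Let $V_0$ be the set of all $\mathcal{P}$-positions of $G$ (positions with $\mathcal{G}_G(p)=0$) and $V_1$ the set of all positions $p$ with $\mathcal{G}_G(p)=1$. The game $G$ is strongly miserable if, for every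 position $p$ of $G$, $\mathcal{G}_G(p)+\mathcal{G}^-_G(p)=1$ when $p\in V_0\cup V_1$, and $\mathcal{G}_G(p)=\mathcal{G}^-_G(p)$ otherwise. *)

(* Defs.v *)
From mathcomp Require Import all_boot.

Set Implicit Arguments.
Unset Strict Implicit.
Unset Printing Implicit Defensive.

Lemma exists_notin (s : seq nat) : exists n, n \notin s.
Proof.
exists (\max_(i <- s) i).+1; apply/negP => sn.
by have := @leq_bigmax_seq _ s xpredT id _ sn isT; rewrite ltnn.
Qed.

Definition mex (s : seq nat) : nat := ex_minn (exists_notin s).

(* Impartial games with finitely many moves from each position and no infinite
   play; the order and multiplicity of the entries of [followers] are
   irrelevant. *)
Record game := Game {
  position :> eqType;
  followers : position -> seq position;
  followers_wf : well_founded (fun q p => q \in followers p)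
}.
Arguments followers {g} p.

Definition grundy (G : game) : G -> nat :=
  Fix (@followers_wf G) (fun=> nat) (fun p rec =>
    mex [seq rec (ssval q) (ssvalP q) | q <- seq_sub_enum (followers p)]).
Arguments grundy : clear implicits.

Lemma grundyE (G : game) (p : G) :
  grundy G p = mex [seq grundy G q | q <- followers p].
Proof.
have eq_mex s t : s =i t -> mex s = mex t.
  by move=> st; apply: eq_ex_minn => n; rewrite st.
rewrite {1}/grundy Fix_eq -/(grundy G).
  apply: eq_mex => n; apply/mapP/mapP => [[q _ ->]|[q pq ->]].
    by exists (ssval q) => //; apply: ssvalP.
  by exists (SeqSub pq) => //; apply: mem_seq_sub_enum.
by move=> q f h fh; congr mex; apply: eq_map => r; apply: fh.
Qed.

Definition terminal (G : game) (p : G) : bool := nilp (followers p).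

(* The extra sink vertex is [None]. *)
Definition misere_followers (G : game) (x : option G) : seq (option G) :=
  if x is Some p then
    if terminal p then [:: None] else [seq Some q | q <- followers p]
  else [::].

Lemma misere_followers_wf (G : game) :
  well_founded (fun y x => y \in @misere_followers G x).
Proof.
have accN : Acc (fun y x => y \in @misere_followers G x) None by split.
case=> [p|]; last exact: accN.
elim: (followers_wf p) => {}p _ IHp.
split=> y /=; case: ifP => _; first by rewrite inE => /eqP->.
by case/mapP => q pq ->; apply: IHp.
Qed.

Definition misere (G : game) : game := Game (@misere_followers_wf G).

Definition misere_grundy (G : game) (p : G) : nat := grundy (misere G) (Some p).
Arguments misere_grundy : clear implicits.

Lemma misere_grundyE (G : game) (p : G) :
  misere_grundy G p =
    if terminal p then 1 else mex [seq misere_grundy G q | q <- followers p].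
Proof.
have mexE s n : n \notin s -> (forall m, m < n -> m \in s) -> mex s = n.
  move=> ns lt_n; rewrite /mex; case: ex_minnP => m ms min_m.
  apply/eqP; rewrite eqn_leq min_m //= leqNgt.
  by apply: contra ms => /lt_n.
rewrite /misere_grundy grundyE /=; case: ifP => _; last by rewrite -map_comp.
have g0 : grundy (misere G) None = 0 by rewrite grundyE /=; apply: mexE.
by rewrite /= g0; apply: mexE => // -[].
Qed.

Definition V (G : game) (v : nat) : pred G := [pred p | grundy G p == v].
Arguments V : clear implicits.

Definition strongly_miserable (G : game) : Prop :=
  forall p : G,
    (p \in V G 0 \/ p \in V G 1 -> grundy G p + misere_grundy G p = 1) /\
    (~ (p \in V G 0 \/ p \in V G 1) -> grundy G p = misere_grundy G p).

(* Unordered pairs of naturals, represented by their sorted form. *)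
Definition upair := {p : nat * nat | p.1 <= p.2}.

Lemma minn_le_maxn (a b : nat) :
  (minn a b, maxn a b).1 <= (minn a b, maxn a b).2.
Proof. by rewrite /= geq_min leq_maxl. Qed.

Definition mk_upair (a b : nat) : upair :=
  exist _ (minn a b, maxn a b) (minn_le_maxn a b).

Lemma mk_upairC (a b : nat) : mk_upair a b = mk_upair b a.
Proof. by apply: val_inj; rewrite /= minnC maxnC. Qed.

Definition fwythoff_followers (p : upair) : seq upair :=
  let: (a, b) := val p in
  [seq mk_upair (a - k) b | k <- iota 1 a] ++
  [seq mk_upair a (b - k) | k <- iota 1 b] ++
  [seq mk_upair (a - k) (b - k)
     | k <- iota 1 b & (k < a) && ((b - k) %/ (a - k) == b %/ a)].

Lemma fwythoff_followersP (a b : nat) (q : upair) : a <= b ->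
  reflect
    [\/ exists2 k, 1 <= k <= a & q = mk_upair (a - k) b,
        exists2 k, 1 <= k <= b & q = mk_upair a (b - k)
      | exists k, [/\ 1 <= k < a, (b - k) %/ (a - k) = b %/ a
                    & q = mk_upair (a - k) (b - k)]]
    (q \in fwythoff_followers (mk_upair a b)).
Proof.
move=> leab; rewrite /fwythoff_followers /= (minn_idPl leab) (maxn_idPr leab).
rewrite !mem_cat; apply: (iffP or3P) => -[].
- by case/mapP=> k; rewrite mem_iota add1n ltnS => ? ->; constructor 1; exists k.
- by case/mapP=> k; rewrite mem_iota add1n ltnS => ? ->; constructor 2; exists k.
- case/mapP=> k; rewrite mem_filter mem_iota => /andP[/andP[ka /eqP e] /andP[k0 _]] ->.
  by constructor 3; exists k; rewrite k0 ka.
- by case=> k ? ->; constructor 1; apply/mapP; exists k; rewrite ?mem_iota ?add1n ?ltnS.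
- by case=> k ? ->; constructor 2; apply/mapP; exists k; rewrite ?mem_iota ?add1n ?ltnS.
case=> k [/andP[k0 ka] e ->]; constructor 3; apply/mapP; exists k => //.
by rewrite mem_filter mem_iota ka k0 e eqxx add1n ltnS ltnW // (leq_trans ka).
Qed.

Lemma fwythoff_followers_wf : well_founded (fun q p => q \in fwythoff_followers p).
Proof.
pose w (p : upair) := (val p).1 + (val p).2.
have wE a b : w (mk_upair a b) = a + b by rewrite /w /= addn_min_max.
suff dec p q : q \in fwythoff_followers p -> w q < w p.
  move=> p; have [n] := ubnP (w p); elim: n p => [p|n IHn p]; rewrite ?ltn0 ?ltnS => wp.
    by discriminate wp.
  by split=> q /dec qp; apply: IHn; apply: leq_trans wp.
case: p => -[a b] /= leab.
have -> : exist _ (a, b) leab = mk_upair a b :> upair.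
  by apply: val_inj; rewrite /= (minn_idPl leab) (maxn_idPr leab).
have subk n k : 1 <= k <= n -> n - k < n.
  by case/andP=> k0 kn; rewrite ltn_subrL k0 (leq_trans k0).
case/(fwythoff_followersP _ leab) => [[k /subk h ->]|[k /subk h ->]|[k [/andP[k0 ka] _ ->]]].
- by rewrite !wE ltn_add2r.
- by rewrite !wE ltn_add2l.
by rewrite !wE -addSn leq_add ?leq_subr // subk // k0 ltnW.
Qed.

Definition fwythoff : game := Game fwythoff_followers_wf.

(* Main.v *)
Require Import Defs.
From mathcomp Require Import all_boot zify.

Set Implicit Arguments.
Unset Strict Implicit.
Unset Printing Implicit Defensive.

(** Let [W] be the set of P-positions [(A n, A n + n)] of Wythoff's game.  In
    F-Wythoff the positions of value 0 are [(0, 0)] and [W + (1, 1)], those of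
    value 1 are [(0, 1)] and [W + (2, 2)]: since [A n >= n], these translates
    have integer ratio 1, so that every diagonal move of Wythoff's game that
    ends in one of them is legal.  Hence every nonterminal position of value 0
    has a follower of value 1, which is all that strong misery requires: then
    exchanging the values 0 and 1 commutes with the mex recursion. *)

(** * Mex and the exchange of the values 0 and 1 *)

Lemma mex_notin (s : seq nat) : mex s \notin s.
Proof. by rewrite /mex; case: ex_minnP. Qed.

Lemma mem_lt_mex (s : seq nat) (m : nat) : m < mex s -> m \in s.
Proof.
rewrite /mex; case: ex_minnP => n _ min_n; rewrite ltnNge.
by apply: contraNT; apply: min_n.
Qed.

Lemma mex_eq (s : seq nat) (n : nat) :
  n \notin s -> (forall m, m < n -> m \in s) -> mex s = n.
Proof.
move=> ns lt_s; case: (ltngtP (mex s) n) => // lt_n.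
  by have := mex_notin s; rewrite lt_s.
by rewrite mem_lt_mex in ns.
Qed.

Lemma mex_eq0 (s : seq nat) : (mex s == 0) = (0 \notin s).
Proof.
apply/eqP/idP => [<-|s0]; first exact: mex_notin.
exact: mex_eq.
Qed.

Lemma mex_eq1 (s : seq nat) : (mex s == 1) = (0 \in s) && (1 \notin s).
Proof.
apply/eqP/andP => [s1|[s0 s1]]; last by apply: mex_eq => // -[].
by split; [rewrite mem_lt_mex ?s1 | rewrite -s1 mex_notin].
Qed.

Definition flip (n : nat) : nat := if n is n'.+2 then n else 1 - n.

Lemma flipK : involutive flip.
Proof. by case=> [|[|n]]. Qed.

Lemma mem_map_flip (s : seq nat) (n : nat) : (n \in map flip s) = (flip n \in s).
Proof. by rewrite -{1}(flipK n) (mem_map (inv_inj flipK)). Qed.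

(** If 0 and 1 were both missing, both mexes would be 0; otherwise [flip] carries the first gap of
    [s] to that of its image. *)
Lemma mex_map_flip (s : seq nat) :
  (0 \in s) || (1 \in s) -> mex (map flip s) = flip (mex s).
Proof.
move=> s01; apply: mex_eq; first by rewrite mem_map_flip flipK mex_notin.
have := mex_notin s; case def_m: (mex s) => [|[|m]] //=.
  move=> s0 [|//] _; rewrite mem_map_flip /=.
  by move: s01; rewrite (negPf s0).
move=> _ n ltnm; rewrite mem_map_flip; apply: mem_lt_mex.
by rewrite def_m; case: n ltnm => [|[|n]].
Qed.

Lemma misere_grundy_flip (G : game) :
    (forall p : G, grundy G p = 0 ->
       terminal p || has (V G 1) (followers p)) ->
  forall p : G, misere_grundy G p = flip (grundy G p).
Proof.
move=> step p; elim: (followers_wf p) => {}p _ IHp.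
rewrite misere_grundyE; case: ifPn => [|np].
  by rewrite /terminal => /nilP p0; rewrite grundyE p0 /= (@mex_eq _ 0).
have /eq_in_map -> :
    {in followers p, misere_grundy G =1 flip \o grundy G} by [].
rewrite map_comp mex_map_flip -?grundyE //.
(* Side condition of [mex_map_flip]: a nonzero value has a follower of value 0, and a nonterminal
   value 0 has one of value 1 by [step]. *)
rewrite -implyNb -mex_eq0 -grundyE; apply/implyP => /eqP /step.
by rewrite (negPf np) => /= /hasP[q pq /eqP <-]; apply: map_f.
Qed.

Lemma strongly_miserable_step (G : game) :
    (forall p : G, grundy G p = 0 ->
       terminal p || has (V G 1) (followers p)) ->
  strongly_miserable G.
Proof.
move=> step p; rewrite (@misere_grundy_flip G step) !inE.
split; first by case=> /eqP->.
by case: (grundy G p) => [|[|n]] //= []; [left|right].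
Qed.

(** * Recognizing the values 0 and 1 by kernels *)

Section Kernels.

Variables (G : game) (K0 K1 : pred G).
Hypothesis K0E : forall p, K0 p = ~~ has K0 (followers p).
Hypothesis K1E : forall p, K1 p = ~~ K0 p && ~~ has K1 (followers p).

Lemma grundy_eq0_kernel : V G 0 =1 K0.
Proof.
move=> p; elim: (followers_wf p) => {}p _ IHp.
rewrite K0E {1}/V /= grundyE mex_eq0 -(eq_in_has IHp); congr (~~ _).
by apply/mapP/hasP => -[q pq]; [move=> e|move=> /eqP e]; exists q => //; apply/eqP.
Qed.

(** [K1] is the kernel of the graph with [K0] deleted, just as value 1 means a nonzero value and no
    follower of value 1. *)
Lemma grundy_eq1_kernel : V G 1 =1 K1.
Proof.
move=> p; elim: (followers_wf p) => {}p _ IHp.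
rewrite K1E -grundy_eq0_kernel -(eq_in_has IHp) {1 2}/V /= grundyE mex_eq1 mex_eq0 negbK.
congr (_ && ~~ _).
by apply/mapP/hasP => -[q pq]; [move=> e|move=> /eqP e]; exists q => //; apply/eqP.
Qed.

Lemma strongly_miserable_kernel :
    (forall p, K0 p -> terminal p || has K1 (followers p)) ->
  strongly_miserable G.
Proof.
move=> step; apply: strongly_miserable_step => p /eqP p0.
by rewrite (eq_has grundy_eq1_kernel) step // -grundy_eq0_kernel.
Qed.

End Kernels.

(** * Wythoff pairs *)

(* The entries of the first [n] P-positions of Wythoff's game. *)
Fixpoint wythoff_used (n : nat) : seq nat :=
  if n is n'.+1 then
    let m := mex (wythoff_used n') in [:: m, m + n' & wythoff_used n']
  else [::].

(** The lower Wythoff sequence [A], given by its mex recursion. *)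
Definition wythoff (n : nat) : nat := mex (wythoff_used n).

Lemma mem_wythoff_used (n m : nat) :
  reflect (exists2 i, i < n & m = wythoff i \/ m = wythoff i + i)
          (m \in wythoff_used n).
Proof.
elim: n => [|n IHn] /=; first by constructor; case.
rewrite !inE -/(wythoff n); apply: (iffP or3P).
  case=> [/eqP->|/eqP->|/IHn[i ltin im]].
  - by exists n => //; left.
  - by exists n => //; right.
  by exists i => //; apply: ltnW.
case=> i; rewrite ltnS leq_eqVlt => /predU1P[-> [] ->|ltin im].
- by constructor 1.
- by constructor 2.
by constructor 3; apply/IHn; exists i.
Qed.

Lemma wythoff0 : wythoff 0 = 0.
Proof. exact: mex_eq. Qed.

Lemma wythoff_lt_mono : {mono wythoff : i j / i < j}.
Proof.
apply: leqW_mono; apply: leq_mono; apply: homo_ltn => // [|n].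
  exact: ltn_trans.
(* Were the next term equal to [wythoff n] or below it, it would already be used, although it is a
   mex of used numbers. *)
rewrite ltnNge leq_eqVlt; apply/negP => /predU1P[e|/mem_lt_mex].
  have /mem_wythoff_used[] := mex_notin (wythoff_used n.+1).
  by exists n => //; left.
case/mem_wythoff_used=> i ltin im.
have /mem_wythoff_used[] := mex_notin (wythoff_used n.+1).
by exists i; rewrite // ltnS ltnW.
Qed.

Lemma leq_wythoff (n : nat) : n <= wythoff n.
Proof.
by elim: n => // n IHn; apply: leq_ltn_trans IHn _; rewrite wythoff_lt_mono.
Qed.

Lemma wythoff_cover (m : nat) : exists i, m = wythoff i \/ m = wythoff i + i.
Proof.
have : m \in wythoff_used m.+1 by apply: mem_lt_mex; apply: leq_wythoff.
by case/mem_wythoff_used=> i _; exists i.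
Qed.

(** If [i < j], monotonicity makes the left side too small; if [j < i], the right side is already
    used when [wythoff i] is chosen. *)
Lemma wythoff_disjoint (i j : nat) : wythoff i = wythoff j + j -> i = j.
Proof.
move=> e; case: (ltngtP i j) => // [|ltji].
  by rewrite -wythoff_lt_mono; lia.
have /mem_wythoff_used[] := mex_notin (wythoff_used i).
by exists j => //; right.
Qed.

Lemma wythoff_inj : injective wythoff.
Proof.
by move=> i j e; case: (ltngtP i j) => //; rewrite -wythoff_lt_mono e ltnn.
Qed.

Lemma wythoff_upper_inj (i j : nat) : wythoff i + i = wythoff j + j -> i = j.
Proof.
by move=> e; case: (ltngtP i j) => // l; move: (l); rewrite -wythoff_lt_mono; lia.
Qed.

(** * Translates of the set of Wythoff pairs *)

(* Membership of [{x, y}] in the translate [W + (c, c)]. *)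
Definition cold (c x y : nat) : bool :=
  minn x y == wythoff (maxn x y - minn x y) + c.

Lemma coldC (c x y : nat) : cold c x y = cold c y x.
Proof. by rewrite /cold minnC maxnC. Qed.

Lemma cold_wythoff (c n : nat) : cold c (wythoff n + c) (wythoff n + n + c).
Proof. by apply/eqP; rewrite (_ : maxn _ _ - _ = n); lia. Qed.

Lemma coldP (c x y : nat) :
  reflect (exists n, x = wythoff n + c /\ y = wythoff n + n + c \/
                     x = wythoff n + n + c /\ y = wythoff n + c)
          (cold c x y).
Proof.
apply: (iffP idP) => [/eqP e|[n [] [-> ->]]]; last 1 first.
- by rewrite coldC cold_wythoff.
- by exists (maxn x y - minn x y); lia.
exact: cold_wythoff.
Qed.

(** A number occurs in only one Wythoff pair, so either entry determines the index. *)
Lemma cold_line (c x y y' : nat) : cold c x y -> cold c x y' -> y = y'.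
Proof.
move=> /coldP[i ei] /coldP[j ej].
suff e : i = j by subst j; lia.
case: ei ej => -[ei _] [] [ej _].
- by apply: wythoff_inj; lia.
- by apply: wythoff_disjoint; lia.
- by apply/esym/wythoff_disjoint; lia.
by apply: wythoff_upper_inj; lia.
Qed.

(** A diagonal move keeps the difference of the entries, which is the index of the pair. *)
Lemma cold_diag (c x y k : nat) :
  k <= minn x y -> cold c x y -> cold c (x - k) (y - k) -> k = 0.
Proof.
move=> lek /eqP e /eqP.
by rewrite (_ : maxn (x - k) _ - _ = maxn x y - minn x y); lia.
Qed.

Lemma cold_shift (c x y k : nat) : cold c x y -> cold (c + k) x y -> k = 0.
Proof. by move=> /eqP e /eqP; lia. Qed.

Lemma cold_geq (c x y : nat) : cold c x y -> (c <= x) && (c <= y).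
Proof. by case/coldP=> n; lia. Qed.

(** The claim amounts to [n < wythoff n + c]; positivity of [c] covers the pair [(0, 0)]. *)
Lemma cold_ratio (c x y : nat) : 0 < c -> x <= y -> cold c x y -> y < 2 * x.
Proof. by move=> c0 lexy /coldP[n]; have := leq_wythoff n; lia. Qed.

(** * Moves of F-Wythoff and the translates *)

Lemma upair_ind (P : upair -> Prop) :
  (forall a b, a <= b -> P (mk_upair a b)) -> forall p, P p.
Proof.
move=> Pmk [[a b] /= leab]; rewrite (_ : exist _ _ _ = mk_upair a b); first exact: Pmk.
by apply: val_inj; rewrite /= (minn_idPl leab) (maxn_idPr leab).
Qed.

Lemma mk_upair_eq (a b x y : nat) :
  (mk_upair a b == mk_upair x y) =
  (a == x) && (b == y) || (a == y) && (b == x).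
Proof. by rewrite -val_eqE /= xpair_eqE; lia. Qed.

Lemma mem_reduce_small (a b x : nat) :
  a <= b -> x < a -> mk_upair x b \in fwythoff_followers (mk_upair a b).
Proof.
move=> leab ltxa; apply/fwythoff_followersP => //; constructor 1.
by exists (a - x); [lia|congr mk_upair; lia].
Qed.

Lemma mem_reduce_large (a b y : nat) :
  a <= b -> y < b -> mk_upair a y \in fwythoff_followers (mk_upair a b).
Proof.
move=> leab ltyb; apply/fwythoff_followersP => //; constructor 2.
by exists (b - y); [lia|congr mk_upair; lia].
Qed.

Lemma divn_eq1 (a b : nat) : a <= b -> b < 2 * a -> b %/ a = 1.
Proof.
move=> leab ltb; rewrite -(subnKC leab) divnDl ?dvdnn // divnn divn_small; lia.
Qed.

Definition coldu (c : nat) (p : upair) : bool := cold c (val p).1 (val p).2.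

Lemma coldu_mk (c x y : nat) : coldu c (mk_upair x y) = cold c x y.
Proof. by rewrite /coldu /cold /= ; congr (_ == wythoff (_ - _) + _); lia. Qed.

Lemma cold_stable (c : nat) (p q : upair) :
  coldu c p -> q \in fwythoff_followers p -> ~~ coldu c q.
Proof.
elim/upair_ind: p => a b leab; rewrite coldu_mk => pc.
case/(fwythoff_followersP _ leab) => [[k lek ->]|[k lek ->]|[k [lek _ ->]]];
  rewrite coldu_mk; apply/negP => qc.
- by rewrite coldC in pc; rewrite coldC in qc; have := cold_line pc qc; lia.
- by have := cold_line pc qc; lia.
by have := cold_diag _ pc qc; lia.
Qed.

Lemma cold_absorbing (c a b : nat) :
  0 < c <= a -> a <= b ->
  cold c a b || has (coldu c) (fwythoff_followers (mk_upair a b)).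
Proof.
move=> /andP[c0 leca] leab.
have [//|nc /=] := boolP (cold c a b); apply/hasP.
(* If [a - c] is an upper entry, its shifted partner is at most [a], hence at most [b]: reduce [b]
   to it. *)
have [i [ei|ei]] := wythoff_cover (a - c); last first.
  have y_c : cold c a (wythoff i + c) by apply/coldP; exists i; lia.
  have [ltb|leb] := ltnP (wythoff i + c) b.
    by exists (mk_upair a (wythoff i + c)); rewrite ?coldu_mk // mem_reduce_large.
  by case/negP: nc; rewrite (_ : b = wythoff i + c) //; lia.
have y_c : cold c a (wythoff i + i + c) by apply/coldP; exists i; lia.
have [ltb|leb] := ltnP (wythoff i + i + c) b.
  by exists (mk_upair a (wythoff i + i + c)); rewrite ?coldu_mk // mem_reduce_large.
have [e|neb] := eqVneq b (wythoff i + i + c); first by rewrite e y_c in nc.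
(* Here [b] lies below the partner of [a], so [j < i], and the diagonal leads down to the shifted
   pair of index [j]. *)
pose j := b - a.
have ltji : wythoff j < wythoff i by rewrite wythoff_lt_mono; lia.
have q_c := cold_wythoff c j.
exists (mk_upair (wythoff j + c) (wythoff j + j + c)); rewrite ?coldu_mk //.
(* This gives ratio 1 at the target, and at the start too, since [j < wythoff j + c < a]. *)
have lt2 := cold_ratio c0 (_ : wythoff j + c <= wythoff j + j + c) q_c.
apply/fwythoff_followersP => //; constructor 3; exists (a - (wythoff j + c)).
have -> : a - (a - (wythoff j + c)) = wythoff j + c by lia.
have -> : b - (a - (wythoff j + c)) = wythoff j + j + c by lia.
by split=> //; [lia | rewrite !divn_eq1 //; lia].
Qed.

(** * The two kernels of F-Wythoff *)

Definition kernel (c : nat) : pred fwythoff :=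
  [pred p | (p == mk_upair 0 c) || coldu c.+1 p].

Lemma kernel_mk (c x y : nat) :
  kernel c (mk_upair x y) =
  (x == 0) && (y == c) || (x == c) && (y == 0) || cold c.+1 x y.
Proof. by rewrite /kernel /= coldu_mk mk_upair_eq. Qed.

Lemma kernel_stable (c : nat) (p : fwythoff) :
  c <= 1 -> kernel c p -> ~~ has (kernel c) (followers p).
Proof.
move=> lec1; elim/upair_ind: p => a b leab pc; apply/hasPn => q pq.
have [ab0|nab0] := boolP (mk_upair a b == mk_upair 0 c).
  move: pq; rewrite mk_upair_eq in ab0.
  by case/(fwythoff_followersP _ leab) => [[k lek ->]|[k lek ->]|[k [lek _ ->]]];
    rewrite kernel_mk; apply/negP => /orP[|/cold_geq]; lia.
have {}pc : coldu c.+1 (mk_upair a b) by case/orP: pc => // ab0; case/negP: nab0.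
rewrite /= negb_or (@cold_stable _ (mk_upair a b)) // andbT.
(* Both entries exceed [c]: a one-pile move leaves one of them unchanged, and a diagonal move leaves
   both positive, so [{0, c}] is out of reach. *)
rewrite coldu_mk in pc; have := cold_geq pc.
by case/(fwythoff_followersP _ leab): pq => [[k lek ->]|[k lek ->]|[k [lek _ ->]]];
  rewrite mk_upair_eq; lia.
Qed.

Lemma kernel_absorbing (c a b : nat) : c < a -> a <= b ->
  kernel c (mk_upair a b) ||
  has (kernel c) (fwythoff_followers (mk_upair a b)).
Proof.
move=> ltca leab; rewrite kernel_mk.
have /orP[->|/hasP[q pq qc]] := @cold_absorbing c.+1 a b ltca leab.
  by rewrite orbT.
by apply/orP; right; apply/hasP; exists q => //; apply/orP; right.
Qed.

Lemma kernel0E (p : fwythoff) : kernel 0 p = ~~ has (kernel 0) (followers p).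
Proof.
apply/idP/idP => [|np]; first exact: kernel_stable.
elim/upair_ind: p np => a b leab np.
have [a0|a0] := posnP a; last first.
  by have := @kernel_absorbing 0 a b a0 leab; rewrite (negPf np) orbF.
subst a; rewrite kernel_mk; have [->//|b0] := posnP b.
case/negP: np; apply/hasP; exists (mk_upair 0 0); first exact: mem_reduce_large.
by rewrite kernel_mk.
Qed.

Lemma kernel1E (p : fwythoff) :
  kernel 1 p = ~~ kernel 0 p && ~~ has (kernel 1) (followers p).
Proof.
apply/idP/andP => [p1|[p0 np]].
  split; last exact: kernel_stable.
  elim/upair_ind: p p1 => a b leab; rewrite !kernel_mk => p1; apply/negP => p0.
  case/orP: p1 => [ab|p1]; first by case/orP: p0 => [|/cold_geq]; lia.
  case/orP: p0 => [|p0]; first by have := cold_geq p1; lia.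
  by have := @cold_shift 1 a b 1 p0 p1.
elim/upair_ind: p p0 np => a b leab p0 np.
have [a1|a1] := ltnP 1 a.
  by have := @kernel_absorbing 1 a b a1 leab; rewrite (negPf np) orbF.
have K01 : kernel 1 (mk_upair 0 1) by rewrite kernel_mk.
(* Of the positions with entries at most 1, [(0, 0)] and [(1, 1)] lie in [kernel 0]. With a larger
   [b], one move reaches [{0, 1}]. *)
have [b1|b1] := leqP b 1.
  case: a b leab a1 b1 p0 {np} => [|[|//]] [|[|//]] // _ _ _; rewrite kernel_mk //.
  by have := cold_wythoff 1 0; rewrite wythoff0 => ->.
case/negP: np; apply/hasP; exists (mk_upair 0 1) => //.
have [a0|a0] := posnP a; first by subst a; apply: mem_reduce_large.
have e : a = 1 by lia.
by subst a; rewrite mk_upairC; apply: mem_reduce_large; lia.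
Qed.

Lemma kernel_step (p : fwythoff) :
  kernel 0 p -> terminal p || has (kernel 1) (followers p).
Proof.
elim/upair_ind: p => a b leab; rewrite kernel_mk.
case/orP=> [ab0|/coldP[n abn]].
  have [a0 b0] : a = 0 /\ b = 0 by lia.
  by subst a b.
apply/orP; right; apply/hasP.
have [ea eb] : a = wythoff n + 1 /\ b = wythoff n + n + 1 by lia.
have [n0|n0] := posnP n.
  exists (mk_upair a 0); last by rewrite kernel_mk ea n0 wythoff0.
  by apply: mem_reduce_large => //; lia.
(* Since [a = (wythoff n - 1) + 2], the number [wythoff n - 1] lies in a pair of index [i < n];
   reduce [b] to its partner shifted by 2. *)
have := leq_wythoff n; have [i ei] := wythoff_cover (wythoff n - 1) => len.
have ltin : i < n by rewrite -wythoff_lt_mono; lia.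
case: ei => ei.
  exists (mk_upair a (wythoff i + i + 2)); first by apply: mem_reduce_large; lia.
  by rewrite kernel_mk; apply/orP; right; apply/coldP; exists i; lia.
exists (mk_upair a (wythoff i + 2)); first by apply: mem_reduce_large; lia.
by rewrite kernel_mk; apply/orP; right; apply/coldP; exists i; lia.
Qed.

Theorem theorem18 : strongly_miserable fwythoff.
Proof. exact: strongly_miserable_kernel kernel0E kernel1E kernel_step. Qed.
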